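(* Let $D$ be an integral domain with quotient field $K$, $X,Y$ indeterminates, $\star$ a semistar operation on $D$, $D_1:=D[X]$, $K_1:=K(X)$. Let $\boldsymbol\Delta_1^\star:=\{Q_1\in\mathrm{Spec}(D_1)\mid Q_1\cap D=(0),\ \text{or } Q_1=(Q_1\cap D)[X]\text{ and }(Q_1\cap D)^{\star_f}\subsetneq D^\star\}$, $\mathcal S_1^\star:=D_1[Y]\setminus\bigcup\{Q_1[Y]\mid Q_1\in\boldsymbol\Delta_1^\star\}$, and define $[\star]:\overline{\boldsymbol F}(D_1)\to\overline{\boldsymbol F}(D_1)$ by $E^{[\star]}:=E[Y]_{\mathcal S_1^\star}\cap K_1$. Then: (a) $[\star]$ is a stable semistar operation of finite type on $D[X]$, i.e. $\widetilde{[\star]}=[\star]$; moreover, if $\star$ is a (semi)star operation on $D$ then $[\star]$ is a (semi)star operation on $D[X]$; (b) $[\widetilde\star]=[\star_f]=[\star]$.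
   Context: $\overline{\boldsymbol F}(A)$ is the set of nonzero $A$-submodules of the quotient field of a domain $A$. A semistar operation on $A$ is a map $\star:\overline{\boldsymbol F}(A)\to\overline{\boldsymbol F}(A)$ with $(xE)^\star=xE^\star$ for nonzero $x$ in the quotient field, $E\subseteq F\Rightarrow E^\star\subseteq F^\star$, $E\subseteq E^\star$, $(E^\star)^\star=E^\star$; a (semi)star operation if $A^\star=A$. $E^{\star_f}=\bigcup\{F^\star\mid F\subseteq E,\ F$ nonzero finitely generated fractional ideal$\}$; $\star$ is of finite type if $\star=\star_f$; stable if $(E\cap F)^\star=E^\star\cap F^\star$. A nonzero ideal $I$ is a quasi-$\star$-ideal if $I^\star\cap A=I$; $\mathrm{QMax}^\star(A)$ is the set of maximal elements among proper quasi-$\star$-ideals. $\widetilde\star$ is the semistar operation $E\mapsto\bigcap\{EA_P\mid P\in\mathrm{QMax}^{\star_f}(A)\}$. $E[Y]_{\mathcal S_1^\star}$ is the $D_1[Y]_{\mathcal S_1^\star}$-submodule of $K(X,Y)$ generated by $E$. *)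

(* Defs.v *)
From HB Require Import structures.
From mathcomp Require Import all_boot all_order all_algebra.
Set Implicit Arguments. Unset Strict Implicit. Unset Printing Implicit Defensive.
Import Order.TTheory GRing.Theory Num.Theory.
Local Open Scope ring_scope.
Notation "x %:F" := (@FracField.tofrac _ x) : ring_scope.

Section Semistar.
Variable A : idomainType.
Local Notation F := {fraction A}.

Definition subset_of {T} (E G : T -> Prop) := forall x, E x -> G x.
Definition same_set {T} (E G : T -> Prop) := forall x, E x <-> G x.

Definition submod (E : F -> Prop) : Prop :=
  [/\ E 0, (forall x y, E x -> E y -> E (x + y))
    & (forall (a : A) x, E x -> E (a%:F * x))].

Definition nzsubmod (E : F -> Prop) : Prop :=
  submod E /\ exists x, x != 0 /\ E x.

Definition scale_set (x : F) (E : F -> Prop) : F -> Prop :=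
  fun y => exists e, E e /\ y = x * e.

Definition Aset : F -> Prop := fun x => exists a : A, x = a%:F.

Definition is_semistar (st : (F -> Prop) -> (F -> Prop)) : Prop :=
  (forall E, nzsubmod E -> nzsubmod (st E)) /\
  (forall E x, nzsubmod E -> x != 0 -> same_set (st (scale_set x E)) (scale_set x (st E))) /\
  (forall E G, nzsubmod E -> nzsubmod G -> subset_of E G -> subset_of (st E) (st G)) /\
  (forall E, nzsubmod E -> subset_of E (st E)) /\
  (forall E, nzsubmod E -> same_set (st (st E)) (st E)).

Definition is_semistar_star (st : (F -> Prop) -> (F -> Prop)) : Prop :=
  is_semistar st /\ same_set (st Aset) Aset.

Definition fg_gen (gs : seq F) : F -> Prop :=
  fun y => exists c : nat -> A, y = \sum_(i < size gs) (c i)%:F * gs`_i.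

Definition star_f (st : (F -> Prop) -> (F -> Prop)) (E : F -> Prop) : F -> Prop :=
  fun y => exists gs : seq F,
    (exists2 g, g \in gs & g != 0) /\ (forall g, g \in gs -> E g) /\ st (fg_gen gs) y.

Definition finite_type (st : (F -> Prop) -> (F -> Prop)) : Prop :=
  forall E, nzsubmod E -> same_set (st E) (star_f st E).

Definition stable (st : (F -> Prop) -> (F -> Prop)) : Prop :=
  forall E G, nzsubmod E -> nzsubmod G ->
    same_set (st (fun x => E x /\ G x)) (fun x => st E x /\ st G x).

Definition ideal (I : A -> Prop) : Prop :=
  [/\ I 0, (forall a b, I a -> I b -> I (a + b)) & (forall a b, I b -> I (a * b))].

Definition prime_ideal (I : A -> Prop) : Prop :=
  [/\ ideal I, ~ I 1 & (forall a b, I (a * b) -> I a \/ I b)].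

Definition embed_ideal (I : A -> Prop) : F -> Prop :=
  fun x => exists2 a, I a & x = a%:F.

Definition quasi_ideal (st : (F -> Prop) -> (F -> Prop)) (I : A -> Prop) : Prop :=
  [/\ ideal I, (exists a, a != 0 /\ I a) &
      (forall a, st (embed_ideal I) a%:F <-> I a)].

Definition QMax (st : (F -> Prop) -> (F -> Prop)) (P : A -> Prop) : Prop :=
  [/\ quasi_ideal st P, ~ P 1 &
      (forall J, quasi_ideal st J -> ~ J 1 -> subset_of P J -> subset_of J P)].

Definition loc (E : F -> Prop) (P : A -> Prop) : F -> Prop :=
  fun x => exists s, ~ P s /\ E (s%:F * x).

Definition tilde (st : (F -> Prop) -> (F -> Prop)) (E : F -> Prop) : F -> Prop :=
  fun x => forall P, QMax (star_f st) P -> loc E P x.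

Definition same_op (st1 st2 : (F -> Prop) -> (F -> Prop)) : Prop :=
  forall E, nzsubmod E -> same_set (st1 E) (st2 E).

End Semistar.

Section Bracket.
Variable D : idomainType.
Local Notation K := {fraction D}.
Local Notation D1 := {poly D}.
Local Notation K1 := {fraction {poly D}}.
Local Notation D1Y := {poly {poly D}}.
Local Notation KXY := {fraction {poly {poly D}}}.

Definition incl (x : K1) : KXY :=
  let r := repr x in (\n_r)%:P%:F / (\d_r)%:P%:F.

Definition Delta (st : (K -> Prop) -> (K -> Prop)) (Q : D1 -> Prop) : Prop :=
  prime_ideal Q /\
  ((forall d : D, Q d%:P -> d = 0) \/
   ((forall p : D1, Q p <-> forall i, Q (p`_i)%:P) /\
    subset_of (star_f st (embed_ideal (fun d : D => Q d%:P))) (st (@Aset D)) /\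
    ~ subset_of (st (@Aset D)) (star_f st (embed_ideal (fun d : D => Q d%:P))))).

Definition Sset (st : (K -> Prop) -> (K -> Prop)) (f : D1Y) : Prop :=
  forall Q, Delta st Q -> ~ (forall i, Q f`_i).

(* E[Y]_{S}: the D_1[Y]_S-submodule of K(X,Y) generated by E *)
Definition genYS (st : (K -> Prop) -> (K -> Prop)) (E : K1 -> Prop) : KXY -> Prop :=
  fun z => exists s, Sset st s /\
    exists n (f : nat -> D1Y) (e : nat -> K1),
      (forall i, (i < n)%N -> E (e i)) /\
      z = (\sum_(i < n) (f i)%:F * incl (e i)) / s%:F.

Definition bracket (st : (K -> Prop) -> (K -> Prop)) (E : K1 -> Prop) : K1 -> Prop :=
  fun x => genYS st E (incl x).

End Bracket.

(* Main.v *)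
(** An element x of K(X) lies in E^[star] iff the conductor (E : x) contains all
    coefficients of some s in S, and S is multiplicatively closed.  This makes
    [star] stable and of finite type; a stable operation of finite type equals
    its tilde because x lies in the closure of E iff 1 lies in the closure of
    (E : x), i.e. iff (E : x) is contained in no quasi-maximal ideal.

    The set Delta, hence [star], depends only on which ideals I of D satisfy
    1 \in I^{star_f}, and these are the same for star, star_f and tilde.

    If D^star = D and s x has coefficients in D[X] for some s in S, then x has a
    denominator in D, as s avoids the primes contracting to 0, and the content
    ideal C of s satisfies 1 \in C^star, as s avoids the extended primes of
    Delta.  A McCoy-type induction on the degree then puts x in D[X]. *)

Require Import Defs.
From HB Require Import structures.
From mathcomp Require Import all_boot all_order all_algebra.
From mathcomp Require boolp classical_sets.
Import GRing.Theory.
Local Open Scope ring_scope.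
Set Implicit Arguments. Unset Strict Implicit. Unset Printing Implicit Defensive.

(** * Ideals maximal among those outside a family of ideals are prime *)

Section PrimeIdealPrinciple.
Variable A : idomainType.
Implicit Types (I J H P : A -> Prop) (L : (A -> Prop) -> Prop).

(** Membership in [L] is witnessed by finitely many elements and passes to larger ideals: this is
    what Zorn's lemma needs in order to find ideals maximal outside [L]. *)
Definition finitary L := forall J, ideal J -> L J ->
  exists gs : seq A, (forall g, g \in gs -> J g) /\
    forall I, ideal I -> (forall g, g \in gs -> I g) -> L I.

(** Quantifying over every ideal [H] that contains the products avoids constructing the product
    ideal. *)
Definition product_closed L := forall I J H, ideal I -> ideal J -> ideal H ->
  L I -> L J -> (forall a b, I a -> J b -> H (a * b)) -> L H.

Definition maximal_avoiding L P :=
  [/\ ideal P, ~ L P &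
      forall J, ideal J -> ~ L J -> subset_of P J -> subset_of J P].

Lemma finitary_sub L I J : finitary L -> ideal I -> ideal J ->
  subset_of I J -> L I -> L J.
Proof.
move=> finL idI idJ sIJ /(finL _ idI)[gs [gsI gsL]].
by apply: gsL => // g /gsI /sIJ.
Qed.

Definition adjoin I (a : A) : A -> Prop :=
  fun x => exists p c, I p /\ x = p + c * a.

Lemma adjoin_ideal I a : ideal I -> ideal (adjoin I a).
Proof.
case=> I0 ID IM; split.
- by exists 0, 0; rewrite mul0r addr0.
- move=> _ _ [p [c [Ip ->]]] [q [d [Iq ->]]]; exists (p + q), (c + d).
  by split; [exact: ID | rewrite mulrDl addrACA].
- move=> b _ [p [c [Ip ->]]]; exists (b * p), (b * c).
  by split; [exact: IM | rewrite mulrDr mulrA].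
Qed.

Lemma maximal_avoiding_adjoin L P a :
  maximal_avoiding L P -> ~ P a -> L (adjoin P a).
Proof.
case=> idP _ maxP nPa; apply: boolp.contrapT => nL; apply: nPa.
apply: (maxP (adjoin P a)) => //; first exact: adjoin_ideal.
  by move=> x Px; exists x, 0; rewrite mul0r addr0.
by exists 0, 1; split; [case: idP | rewrite mul1r add0r].
Qed.

(** If [a * b] lies in [P] but [a] and [b] do not, then P + (a) and P + (b) belong to [L] by
    maximality. Products of their elements fall into [P], which would put [P] in [L]. *)
Lemma maximal_avoiding_prime L P : finitary L -> product_closed L ->
  L (fun=> True) -> maximal_avoiding L P -> prime_ideal P.
Proof.
move=> finL mulL L1 maxP; have [idP nLP _] := maxP; split=> //.
  move=> P1; apply: nLP; apply: (finitary_sub finL _ idP _ L1) => // x _.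
  by rewrite -[x]mulr1; case: idP => _ _; exact.
move=> a b Pab; apply: boolp.contrapT => /boolp.not_orP[nPa nPb]; apply: nLP.
apply: (mulL (adjoin P a) (adjoin P b)) => //; try exact: adjoin_ideal.
- exact: maximal_avoiding_adjoin.
- exact: maximal_avoiding_adjoin.
move=> _ _ [p [c [Pp ->]]] [q [d [Pq ->]]]; case: idP => _ PD PM.
rewrite mulrDl; apply: (PD); first by rewrite mulrC; exact: PM.
by rewrite mulrDr; apply: (PD); [exact: PM | rewrite mulrACA; exact: PM].
Qed.

Lemma chain_seq (F : (A -> Prop) -> Prop) (X0 : A -> Prop) (gs : seq A) :
  F X0 -> (forall X Y, F X -> F Y -> subset_of X Y \/ subset_of Y X) ->
  (forall g, g \in gs -> exists2 X, F X & X g) ->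
  exists2 X, F X & forall g, g \in gs -> X g.
Proof.
move=> FX0 tot; elim: gs => [|g gs IH] cov; first by exists X0.
have [|X FX Xgs] := IH; first by move=> h hgs; apply: cov; rewrite inE hgs orbT.
have [Y FY Yg] := cov g (mem_head _ _).
case: (tot _ _ FX FY) => [sXY|sYX].
  by exists Y => // h; rewrite inE => /orP[/eqP->//|/Xgs/sXY].
by exists X => // h; rewrite inE => /orP[/eqP->|/Xgs//]; exact: sYX.
Qed.

(** Zorn's lemma applies because the union of a nonempty chain still avoids [L]: a finite witness of
    membership in [L] would already lie in one member of the chain. *)
Lemma maximal_avoiding_exists L I : finitary L -> ideal I -> ~ L I ->
  exists2 P, maximal_avoiding L P & subset_of I P.
Proof.
move=> finL idI nLI.
pose T := {J : A -> Prop | [/\ ideal J, ~ L J & subset_of I J]}.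
pose R (s t : T) := boolp.asbool (subset_of (sval s) (sval t)).
have t0 : T by exists I; split.
have [|r s t /boolp.asboolP rs /boolp.asboolP st||[P [idP nLP sIP]] maxP] :=
  @classical_sets.ZL_preorder T t0 R.
- by move=> t; apply/boolp.asboolP.
- by apply/boolp.asboolP => x /rs/st.
- move=> C totC; have [[s0 Cs0]|C0] := boolp.lem (exists s, C s); last first.
    by exists t0 => s Cs; case: C0; exists s.
  pose F J := exists2 s, C s & J = sval s.
  have totF X Y : F X -> F Y -> subset_of X Y \/ subset_of Y X.
    move=> [s Cs ->] [t Ct ->].
    by case: (totC _ _ Cs Ct) => /boolp.asboolP; [left|right].
  have FU2 x y : (exists2 X, F X & X x) -> (exists2 X, F X & X y) ->
      exists2 X, F X & X x /\ X y.
    move=> [X FX Xx] [Y FY Yy]; case: (totF _ _ FX FY) => s.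
      by exists Y => //; split=> //; exact: s.
    by exists X => //; split=> //; exact: s.
  pose U x := exists2 X, F X & X x.
  have FP X : F X -> [/\ ideal X, ~ L X & subset_of I X].
    by case=> s _ ->; exact: svalP s.
  have FX0 : F (sval s0) by exists s0.
  have idU : ideal U.
    split.
    - by exists (sval s0) => //; have [[]] := FP _ FX0.
    - move=> a b Ua Ub; have [X FX [Xa Xb]] := FU2 _ _ Ua Ub.
      by exists X => //; have [[_ XD _] _ _] := FP _ FX; exact: XD.
    - move=> a b [X FX Xb].
      by exists X => //; have [[_ _ XM] _ _] := FP _ FX; exact: XM.
  have UP : [/\ ideal U, ~ L U & subset_of I U].
    split=> // [/(finL _ idU)[gs [gsU gsL]]|x Ix].
      have [X FX Xgs] := chain_seq FX0 totF gsU.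
      by have [idX nLX _] := FP _ FX; apply: nLX; exact: gsL.
    by exists (sval s0) => //; have [_ _] := FP _ FX0; exact.
  exists (exist _ U UP : T) => s Cs; apply/boolp.asboolP => x sx /=.
  by exists (sval s) => //; exists s.
exists P => //; split=> // J idJ nLJ sPJ.
have JP : [/\ ideal J, ~ L J & subset_of I J] by split=> // x /sIP/sPJ.
have /= := maxP (exist _ J JP); rewrite /R => /(_ _)/boolp.asboolP; apply.
exact/boolp.asboolP.
Qed.

End PrimeIdealPrinciple.

(** * Finitely generated submodules of the quotient field *)

Section FinitelyGenerated.
Variable A : idomainType.
Local Notation F := {fraction A}.
Implicit Types (E G : F -> Prop) (gs hs : seq F).

Lemma submod_sum E n (P : pred 'I_n) (f : 'I_n -> F) :
  submod E -> (forall i, P i -> E (f i)) -> E (\sum_(i < n | P i) f i).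
Proof. by case=> E0 ED _ Ef; elim/big_ind: _. Qed.

Lemma submodI E G : submod E -> submod G -> submod (fun x => E x /\ G x).
Proof.
move=> [E0 ED EM] [G0 GD GM]; split=> //.
- by move=> x y [? ?] [? ?]; split; [exact: ED | exact: GD].
- by move=> a x [? ?]; split; [exact: EM | exact: GM].
Qed.

Lemma fg_gen_sub E gs : submod E -> (forall g, g \in gs -> E g) ->
  subset_of (fg_gen gs) E.
Proof.
move=> sE gsE _ [c ->]; apply: submod_sum => // i _.
by case: sE => _ _; apply; apply: gsE; rewrite mem_nth.
Qed.

Lemma fg_gen_mem gs g : g \in gs -> fg_gen gs g.
Proof.
move=> ggs; exists (fun i => (i == index g gs)%:R).
have lt : (index g gs < size gs)%N by rewrite index_mem.
rewrite (bigD1 (Ordinal lt)) //= eqxx tofrac1 mul1r nth_index //.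
rewrite big1 ?addr0 // => i ni; suff -> : (i == index g gs :> nat) = false.
  by rewrite tofrac0 mul0r.
by apply/negbTE; apply: contraNneq ni => e; apply/eqP/val_inj.
Qed.

Lemma fg_gen_submod gs : submod (fg_gen gs).
Proof.
split.
- by exists (fun=> 0); rewrite big1 // => i _; rewrite tofrac0 mul0r.
- move=> _ _ [c ->] [d ->]; exists (fun i => c i + d i).
  by rewrite -big_split; apply: eq_bigr => i _; rewrite /= tofracD mulrDl.
- move=> a _ [c ->]; exists (fun i => a * c i).
  by rewrite mulr_sumr; apply: eq_bigr => i _; rewrite tofracM mulrA.
Qed.

Lemma fg_gen_nz gs : (exists2 g, g \in gs & g != 0) -> nzsubmod (fg_gen gs).
Proof.
case=> g ggs g0; split; first exact: fg_gen_submod.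
by exists g; split=> //; exact: fg_gen_mem.
Qed.

Lemma embed_ideal_submod (I : A -> Prop) : ideal I -> submod (embed_ideal I).
Proof.
case=> I0 ID IM; split.
- by exists 0; rewrite ?tofrac0.
- move=> _ _ [a Ia ->] [b Ib ->].
  by exists (a + b); [exact: ID | rewrite tofracD].
- by move=> a _ [b Ib ->]; exists (a * b); [exact: IM | rewrite tofracM].
Qed.

Lemma embed_ideal_nz (I : A -> Prop) a : ideal I -> a != 0 -> I a ->
  nzsubmod (embed_ideal I).
Proof.
move=> idI a0 Ia; split; first exact: embed_ideal_submod.
by exists a%:F; rewrite tofrac_eq0; split=> //; exists a.
Qed.

Lemma Aset_nz : nzsubmod (@Aset A).
Proof.
split; last by exists 1; rewrite oner_neq0; split=> //; exists 1; rewrite tofrac1.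
split.
- by exists 0; rewrite tofrac0.
- by move=> _ _ [a ->] [b ->]; exists (a + b); rewrite tofracD.
- by move=> a _ [b ->]; exists (a * b); rewrite tofracM.
Qed.

Lemma frac_numden (x : F) : x = (\n_(repr x))%:F / (\d_(repr x))%:F.
Proof.
have d0 := denom_ratioP (repr x).
(* With the denominator cleared, the identity is checked on representing pairs through the
   equivalence that defines the fraction field. *)
apply: (canRL (mulfK _)); first by rewrite tofrac_eq0.
rewrite -[X in X * _ = _]reprK; unlock FracField.tofrac.
rewrite -[LHS]FracField.pi_mul; apply/eqmodP => /=.
rewrite FracField.equivfE /FracField.mulf !numden_Ratio ?mulr1 ?oner_neq0 //.
by rewrite mulrC.
Qed.

End FinitelyGenerated.

(** * Calculus of semistar operations and the associated operation of finite type *)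

Section SemistarOperations.
Variable A : idomainType.
Local Notation F := {fraction A}.
Implicit Types (E G : F -> Prop) (gs hs : seq F) (I J P : A -> Prop).
Implicit Types st : (F -> Prop) -> (F -> Prop).

Lemma scale_set_nz E x : nzsubmod E -> x != 0 -> nzsubmod (scale_set x E).
Proof.
move=> [[E0 ED EM] [e [e0 Ee]]] x0; split; last first.
  by exists (x * e); rewrite mulf_neq0 //; split=> //; exists e.
split.
- by exists 0; rewrite mulr0.
- move=> _ _ [y [Ey ->]] [z [Ez ->]]; exists (y + z).
  by split; [exact: ED | rewrite mulrDr].
- move=> a _ [y [Ey ->]]; exists (a%:F * y).
  by split; [exact: EM | rewrite mulrCA].
Qed.

(** For nonzero [x], x E^star = (xE)^star is contained in (G^star)^star = G^star. The scaling axiom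
    says nothing about [x = 0], which is treated apart. *)
Lemma semistar_mul st E G x y : is_semistar st -> nzsubmod E -> nzsubmod G ->
  (forall e, E e -> st G (x * e)) -> st E y -> st G (x * y).
Proof.
move=> [nz [sc [mono [_ idem]]]] nE nG EG Ey.
have [->|x0] := eqVneq x 0; first by rewrite mul0r; have [[]] := nz _ nG.
have nxE := scale_set_nz nE x0.
apply/(idem _ nG _); apply: (mono (scale_set x E)) => //; first exact: nz.
  by move=> _ [e [Ee ->]]; exact: EG.
by apply/(sc _ _ nE x0 _); exists y.
Qed.

Lemma semistar_sub st E : is_semistar st -> nzsubmod E -> subset_of E (st E).
Proof. by case=> _ [_ [_ [sub _]]]; exact: sub. Qed.

Lemma semistar_mono st E G : is_semistar st -> nzsubmod E -> nzsubmod G ->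
  subset_of E G -> subset_of (st E) (st G).
Proof. by case=> _ [_ [mono _]]; exact: mono. Qed.

Lemma semistar_least st E G : is_semistar st -> nzsubmod E -> nzsubmod G ->
  subset_of E (st G) -> subset_of (st E) (st G).
Proof.
move=> sst nE nG EG y Ey; rewrite -[y]mul1r.
by apply: (semistar_mul sst nE nG _ Ey) => e; rewrite mul1r; exact: EG.
Qed.

Lemma semistar_fg_mono st gs hs : is_semistar st ->
  (exists2 g, g \in gs & g != 0) -> {subset gs <= hs} ->
  subset_of (st (fg_gen gs)) (st (fg_gen hs)).
Proof.
move=> sst [g ggs g0] gshs; apply: semistar_mono => //.
- by apply: fg_gen_nz; exists g.
- by apply: fg_gen_nz; exists g => //; exact: gshs.
by apply: fg_gen_sub => [|h /gshs]; [exact: fg_gen_submod | exact: fg_gen_mem].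
Qed.

Lemma star_f_le st E : is_semistar st -> nzsubmod E ->
  subset_of (star_f st E) (st E).
Proof.
move=> sst nE y [gs [gs0 [gsE]]].
apply: semistar_mono => //; first exact: fg_gen_nz.
by apply: fg_gen_sub => //; case: nE.
Qed.

Lemma star_f_mono st E G :
  subset_of E G -> subset_of (star_f st E) (star_f st G).
Proof.
move=> EG y [gs [gs0 [gsE gsy]]]; exists gs.
by split=> //; split=> // g /gsE/EG.
Qed.

Lemma star_f_fg st gs : is_semistar st -> (exists2 g, g \in gs & g != 0) ->
  same_set (star_f st (fg_gen gs)) (st (fg_gen gs)).
Proof.
move=> sst gs0 y; split; first by apply: star_f_le => //; exact: fg_gen_nz.
by exists gs; split=> //; split=> // g /fg_gen_mem.
Qed.

Lemma star_f_Aset st : is_semistar st ->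
  same_set (star_f st (@Aset A)) (st (@Aset A)).
Proof.
move=> sst y; split; first by apply: star_f_le => //; exact: Aset_nz.
move=> Ay; exists [:: 1]; split; first by exists 1; rewrite ?inE ?oner_neq0.
split; first by move=> g; rewrite inE => /eqP->; exists 1; rewrite tofrac1.
apply: semistar_mono Ay => //; first exact: Aset_nz.
  by apply: fg_gen_nz; exists 1; rewrite ?inE ?oner_neq0.
move=> _ [a ->]; rewrite -[a%:F]mulr1; have [_ _] := fg_gen_submod [:: 1 : F].
by apply; apply: fg_gen_mem; rewrite inE.
Qed.

Lemma star_f_sub st E : is_semistar st -> nzsubmod E ->
  subset_of E (star_f st E).
Proof.
move=> sst nE x Ex; have [_ [e [e0 Ee]]] := nE.
(* The nonzero [e] joins the generators because [x] may be zero. *)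
have ne0 : exists2 g, g \in [:: x; e] & g != 0 by exists e; rewrite ?inE ?eqxx ?orbT.
exists [:: x; e]; split=> //; split; first by move=> g; rewrite !inE => /orP[] /eqP->.
by apply: semistar_sub => //; [exact: fg_gen_nz | apply: fg_gen_mem; rewrite inE eqxx].
Qed.

(** Concatenating the two lists of generators shows that the union defining [star_f] is directed,
    whence its stability under addition. *)
Lemma star_f_cat st E x y : is_semistar st -> star_f st E x -> star_f st E y ->
  exists gs, [/\ exists2 g, g \in gs & g != 0, forall g, g \in gs -> E g,
    st (fg_gen gs) x & st (fg_gen gs) y].
Proof.
move=> sst [gs [[g ggs g0] [gsE gsx]]] [hs [[h hhs h0] [hsE hsy]]].
have ne0 : exists2 k, k \in gs ++ hs & k != 0 by exists g; rewrite ?mem_cat ?ggs.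
exists (gs ++ hs); split=> //.
- by move=> k; rewrite mem_cat => /orP[/gsE|/hsE].
- apply: semistar_fg_mono gsx => //; first by exists g.
  by move=> k kgs; rewrite mem_cat kgs.
- apply: semistar_fg_mono hsy => //; first by exists h.
  by move=> k khs; rewrite mem_cat khs orbT.
Qed.

Lemma star_f_nz st E : is_semistar st -> nzsubmod E -> nzsubmod (star_f st E).
Proof.
move=> sst nE; have [[E0 _ _] [e [e0 Ee]]] := nE.
split; last by exists e; split=> //; exact: star_f_sub.
have nzst gs : (exists2 g, g \in gs & g != 0) -> submod (st (fg_gen gs)).
  by move/fg_gen_nz; case: sst => nz _ /nz[].
split; first exact: star_f_sub.
- move=> x y Ex Ey; have [gs [gs0 gsE gsx gsy]] := star_f_cat sst Ex Ey.
  exists gs; do 2!split=> //.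
  by have [_ stD _] := nzst _ gs0; exact: stD.
- move=> a x [gs [gs0 [gsE gsx]]]; exists gs; do 2!split=> //.
  by have [_ _ stM] := nzst _ gs0; exact: stM.
Qed.

Lemma star_f_mul st E G x y : is_semistar st -> x != 0 ->
  (forall e, E e -> G (x * e)) -> star_f st E y -> star_f st G (x * y).
Proof.
move=> sst x0 EG [gs [gs0 [gsE gsy]]]; exists [seq x * g | g <- gs].
have [g ggs g0] := gs0.
have ne0 : exists2 h, h \in [seq x * g | g <- gs] & h != 0.
  by exists (x * g); rewrite ?mulf_neq0 //; exact: map_f.
split=> //; split; first by move=> _ /mapP[h /gsE/EG ? ->].
apply: semistar_mul gsy => //; try exact: fg_gen_nz.
move=> e [c ->]; apply: semistar_sub => //; first exact: fg_gen_nz.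
rewrite mulr_sumr; apply: submod_sum => [|i _]; first exact: fg_gen_submod.
rewrite mulrCA; have [_ _] := fg_gen_submod [seq x * g | g <- gs]; apply.
by apply: fg_gen_mem; apply: map_f; rewrite mem_nth.
Qed.

(** Directedness for finitely many elements at once; it yields the idempotence of [star_f]. *)
Lemma star_f_seq st E gs : is_semistar st -> nzsubmod E ->
  (forall g, g \in gs -> star_f st E g) ->
  exists2 hs, (exists2 h, h \in hs & h != 0) /\ (forall h, h \in hs -> E h) &
    forall g, g \in gs -> st (fg_gen hs) g.
Proof.
move=> sst nE; have [_ [e [e0 Ee]]] := nE.
elim: gs => [_|g gs IH Egs].
  exists [:: e] => //; split; first by exists e; rewrite ?inE.
  by move=> h; rewrite inE => /eqP->.
have [|hs [[h hhs h0] hsE] hsgs] := IH.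
  by move=> k kgs; apply: Egs; rewrite inE kgs orbT.
have [ks [[k kks k0] [ksE ksg]]] := Egs g (mem_head _ _).
have nhk : exists2 l, l \in hs ++ ks & l != 0 by exists h; rewrite ?mem_cat ?hhs.
exists (hs ++ ks).
  by split=> // l; rewrite mem_cat => /orP[/hsE|/ksE].
move=> l; rewrite inE => /orP[/eqP->|/hsgs hsl].
  apply: semistar_fg_mono ksg => //; first by exists k.
  by move=> m mks; rewrite mem_cat mks orbT.
apply: semistar_fg_mono hsl => //; first by exists h.
by move=> m mhs; rewrite mem_cat mhs.
Qed.

Lemma star_f_semistar st : is_semistar st -> is_semistar (star_f st).
Proof.
move=> sst; split; first by move=> E; exact: star_f_nz.
split=> [E x nE x0 y|].
  split=> [xEy|[e [Ee ->]]].
    (* The inclusion of the closure of xE in x times the closure of E is the other inclusion for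
       [x^-1]. *)
    exists (x^-1 * y); rewrite mulVKf //; split=> //.
    apply: star_f_mul xEy => //; first by rewrite invr_eq0.
    by move=> _ [e [Ee ->]]; rewrite mulKf.
  by apply: star_f_mul Ee => // e' Ee'; exists e'.
split; first by move=> E G _ _; exact: star_f_mono.
split; first by move=> E; exact: star_f_sub.
move=> E nE y; split; last by apply: star_f_sub => //; exact: star_f_nz.
move=> [gs [gs0 [/(star_f_seq sst nE)[hs [hs0 hsE] hsgs] gsy]]].
exists hs; split=> //; split=> //.
apply: semistar_least gsy => //; try exact: fg_gen_nz.
apply: fg_gen_sub => //; case: sst => nz _.
by have [] := nz _ (fg_gen_nz hs0).
Qed.

Lemma star_f_idem st E : is_semistar st ->
  same_set (star_f (star_f st) E) (star_f st E).
Proof.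
move=> sst y; split=> -[gs [gs0 [gsE gsy]]]; exists gs; do 2!split=> //.
  exact/(star_f_fg sst gs0 y).
exact/(star_f_fg sst gs0 y).
Qed.

End SemistarOperations.

(** * Quasi-maximal ideals and the tilde operation *)

Section QuasiMaximalIdeals.
Variable A : idomainType.
Local Notation F := {fraction A}.
Implicit Types (E G : F -> Prop) (gs hs : seq F) (I J P : A -> Prop).
Implicit Types st : (F -> Prop) -> (F -> Prop).

(** For a semistar operation and an ideal [J], this amounts to J^{star_f} = A^star. *)
Definition star_dense st J : Prop := star_f st (embed_ideal J) 1.

Definition colon E (x : F) : A -> Prop := fun a => E (a%:F * x).

Lemma colon_ideal E x : submod E -> ideal (colon E x).
Proof.
case=> E0 ED EM; split; rewrite /colon.
- by rewrite tofrac0 mul0r.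
- by move=> a b Ea Eb; rewrite tofracD mulrDl; exact: ED.
- by move=> a b Eb; rewrite tofracM -mulrA; exact: EM.
Qed.

Lemma colon_nz E x : nzsubmod E -> exists a, a != 0 /\ colon E x a.
Proof.
move=> [[E0 _ EM] [e [e0 Ee]]].
have dx := denom_ratioP (repr x); have de := denom_ratioP (repr e).
have ne0 : \n_(repr e) != 0.
  by apply: contraNneq e0 => n0; rewrite (frac_numden e) n0 tofrac0 mul0r.
(* Writing x = n_x / d_x and e = n_e / d_e, one has (d_x n_e) x = (n_x d_e) e, a multiple of [e]. *)
exists (\d_(repr x) * \n_(repr e)); split; first by rewrite mulf_neq0.
rewrite /colon.
suff -> : (\d_(repr x) * \n_(repr e))%:F * x = (\n_(repr x) * \d_(repr e))%:F * e.
  exact: EM.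
rewrite [X in _ * X = _]frac_numden [X in _ = _ * X]frac_numden !tofracM.
rewrite [X in X * _ = _]mulrC [LHS]mulrACA [RHS]mulrACA.
by rewrite !mulfV ?tofrac_eq0 // !mulr1 mulrC.
Qed.

Lemma embed_ideal_seq J gs : (forall g, g \in gs -> embed_ideal J g) ->
  exists2 bs : seq A, gs = [seq b%:F | b <- bs] & forall b, b \in bs -> J b.
Proof.
elim: gs => [|g gs IH] gsJ; first by exists [::].
have [|bs -> bsJ] := IH; first by move=> h hgs; apply: gsJ; rewrite inE hgs orbT.
have [b Jb ->] := gsJ g (mem_head _ _); exists (b :: bs) => // c.
by rewrite inE => /orP[/eqP->|/bsJ].
Qed.

Lemma star_dense_finitary st : finitary (star_dense st).
Proof.
move=> J _ [gs [gs0 [/embed_ideal_seq[bs gsE bsJ] gs1]]]; exists bs; split=> //.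
move=> I _ bsI; exists gs; split=> //; split=> // g.
by rewrite gsE => /mapP[b /bsI Ib ->]; exists b.
Qed.

Lemma star_dense_nz st J : star_dense st J -> exists a, a != 0 /\ J a.
Proof.
case=> gs [[g ggs g0] [gsJ _]]; have [a Ja ga] := gsJ g ggs.
by exists a; split=> //; rewrite ga tofrac_eq0 in g0.
Qed.

(** For i in [I], iJ is contained in [H], so 1 in J^{star_f} gives i in H^{star_f}. Hence [I] lies
    in H^{star_f}, and so does 1. *)
Lemma star_dense_mul st : is_semistar st -> product_closed (star_dense st).
Proof.
move=> /star_f_semistar sst I J H idI idJ idH LI LJ IJH.
have [a [a0 Ia]] := star_dense_nz LI; have [b [b0 Jb]] := star_dense_nz LJ.
have nI := embed_ideal_nz idI a0 Ia; have nJ := embed_ideal_nz idJ b0 Jb.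
have nH := embed_ideal_nz idH (mulf_neq0 a0 b0) (IJH _ _ Ia Jb).
apply: (semistar_least sst nI nH) => // _ [i Ii ->]; rewrite -[i%:F]mulr1.
apply: (semistar_mul sst nJ nH _ LJ) => _ [j Jj ->].
by apply: semistar_sub => //; exists (i * j); [exact: IJH | rewrite tofracM].
Qed.

Lemma star_dense_whole st : is_semistar st -> star_dense st (fun=> True).
Proof.
move=> sst; apply: star_f_sub => //; last by exists 1; rewrite ?tofrac1.
by apply: (@embed_ideal_nz _ _ 1); rewrite ?oner_neq0.
Qed.

Definition quasi_closure st J : A -> Prop :=
  fun a => star_f st (embed_ideal J) a%:F.

Lemma quasi_closure_sub st J a : is_semistar st -> ideal J -> a != 0 -> J a ->
  subset_of J (quasi_closure st J).
Proof.
move=> sst idJ a0 Ja b Jb; apply: star_f_sub => //; last by exists b.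
exact: (embed_ideal_nz idJ a0).
Qed.

Lemma quasi_closure_ideal st J a : is_semistar st -> ideal J -> a != 0 -> J a ->
  quasi_ideal (star_f st) (quasi_closure st J).
Proof.
move=> sst idJ a0 Ja; have nJ := embed_ideal_nz idJ a0 Ja.
have nC := star_f_nz sst nJ; have JC := quasi_closure_sub sst idJ a0 Ja.
have idC : ideal (quasi_closure st J).
  have [C0 CD CM] := colon_ideal 1 (proj1 nC); rewrite /quasi_closure.
  by split=> [|b c|b c]; [move: C0 | move: (CD b c) | move: (CM b c)];
    rewrite /colon !mulr1.
split=> //; first by exists a; split=> //; exact: JC.
move=> b; split=> Cb.
  have sst' := star_f_semistar sst.
  by apply: (semistar_least sst' (embed_ideal_nz idC a0 (JC _ Ja)) nJ _ Cb) => _ [c Cc ->].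
by apply: star_f_sub => //; [exact: embed_ideal_nz (JC _ Ja) | exists b].
Qed.

(** The quasi-closure of a non-dense ideal is a proper quasi-ideal, so maximality among proper
    quasi-ideals agrees with maximality among non-dense ideals. The nonzero element excludes the
    zero ideal, which is maximal non-dense when [A] is a field. *)
Lemma QMax_star_f st P : is_semistar st ->
  QMax (star_f st) P <->
  maximal_avoiding (star_dense st) P /\ exists a, a != 0 /\ P a.
Proof.
move=> sst; split=> [[[idP nP PE] nP1 maxP]|[[idP nLP maxP] [a [a0 Pa]]]].
  split=> //; split=> // [|J idJ nLJ PJ b Jb].
    by rewrite /star_dense -tofrac1 => /PE.
  have [a [a0 Pa]] := nP; have Ja := PJ _ Pa.
  apply: (maxP (quasi_closure st J)).
  - exact: quasi_closure_ideal Ja.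
  - by rewrite /quasi_closure tofrac1.
  - by move=> c /PJ; exact: (quasi_closure_sub sst idJ a0 Ja).
  - exact: (quasi_closure_sub sst idJ a0 Ja).
have qP := quasi_closure_ideal sst idP a0 Pa.
have PC : subset_of (quasi_closure st P) P.
  apply: maxP; last exact: (quasi_closure_sub sst idP a0 Pa).
    by case: qP.
  rewrite /star_dense -tofrac1; case: qP => _ _ qE /qE.
  by rewrite /quasi_closure tofrac1.
split.
- split=> //; first by exists a.
  by move=> b; split; [exact: PC | exact: (quasi_closure_sub sst idP a0 Pa)].
- by move=> P1; apply: nLP; have := quasi_closure_sub sst idP a0 Pa P1;
    rewrite /quasi_closure tofrac1.
- move=> J [idJ _ JE] nJ1 PJ; apply: maxP => //.
  by rewrite /star_dense -tofrac1 => /JE.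
Qed.

Lemma QMax_prime st P : is_semistar st -> QMax (star_f st) P -> prime_ideal P.
Proof.
move=> sst /(QMax_star_f _ sst)[maxP _]; apply: maximal_avoiding_prime maxP.
- exact: star_dense_finitary.
- exact: star_dense_mul.
- exact: star_dense_whole.
Qed.

Lemma QMax_exists st J : is_semistar st -> ideal J ->
  (exists a, a != 0 /\ J a) -> ~ star_dense st J ->
  exists2 P, QMax (star_f st) P & subset_of J P.
Proof.
move=> sst idJ [a [a0 Ja]] nJ.
have [P maxP JP] := maximal_avoiding_exists (@star_dense_finitary st) idJ nJ.
exists P => //; apply/QMax_star_f => //; split=> //.
by exists a; split=> //; exact: JP.
Qed.

Lemma QMax_not_dense st P : QMax (star_f st) P -> ~ star_dense st P.
Proof. by case=> -[_ _ PE] nP1 _; rewrite /star_dense -tofrac1 => /PE. Qed.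

Lemma loc_submod E P : prime_ideal P -> submod E -> submod (loc E P).
Proof.
move=> [_ nP1 Pp] [E0 ED EM]; split.
- by exists 1; split=> //; rewrite mulr0.
- move=> x y [s [Ps Ex]] [t [Pt Ey]]; exists (s * t); split; first by case/Pp.
  rewrite mulrDr !tofracM; apply: ED; last by rewrite -mulrA; exact: EM.
  by rewrite [s%:F * _]mulrC -mulrA; exact: EM.
- by move=> a x [s [Ps Ex]]; exists s; split=> //; rewrite mulrCA; exact: EM.
Qed.

Lemma tilde_sub st E : is_semistar st -> subset_of E (tilde st E).
Proof.
move=> sst x Ex P /(QMax_prime sst)[_ nP1 _].
by exists 1; rewrite tofrac1 mul1r.
Qed.

Lemma tilde_semistar st : is_semistar st -> is_semistar (tilde st).
Proof.
move=> sst; split=> [E [sE [e [e0 Ee]]]|].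
  split; last by exists e; split=> //; exact: tilde_sub.
  split.
  - by apply: tilde_sub => //; case: sE.
  - move=> x y Ex Ey P QP; have [_ lD _] := loc_submod (QMax_prime sst QP) sE.
    by apply: lD; [exact: Ex | exact: Ey].
  - move=> a x Ex P QP; have [_ _ lM] := loc_submod (QMax_prime sst QP) sE.
    by apply: lM; exact: Ex.
split=> [E x nE x0 y|].
  split=> [xEy|[e [Ee ->]] P /Ee[s [Ps Es]]]; last first.
    by exists s; split=> //; exists (s%:F * e); rewrite mulrCA.
  exists (x^-1 * y); rewrite mulVKf //; split=> // P /xEy[s [Ps [e [Ee sy]]]].
  by exists s; split=> //; rewrite mulrCA sy mulKf.
split=> [E G _ _ EG x Ex P /Ex[s [Ps /EG]]|]; first by exists s.
split=> [E _|E _ x]; first exact: tilde_sub.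
split; last exact: tilde_sub.
move=> Ex P QP; have [s [Ps /(_ P QP)[t [Pt Et]]]] := Ex P QP.
exists (t * s); rewrite tofracM -mulrA; split=> //.
by have [_ _ Pp] := QMax_prime sst QP; case/Pp.
Qed.

(** If x lies in the tilde closure, the conductor (E : x) is contained in no quasi-maximal ideal, so
    it is dense. As x (E : x) is contained in [E], x = x * 1 lies in E^{star_f}. *)
Lemma tilde_le st E : is_semistar st -> nzsubmod E ->
  subset_of (tilde st E) (star_f st E).
Proof.
move=> sst nE x Ex; have idJ := colon_ideal x (proj1 nE).
have [a [a0 Ja]] := colon_nz x nE.
have [LJ|nLJ] := boolp.lem (star_dense st (colon E x)); last first.
  have [|P QP JP] := QMax_exists sst idJ _ nLJ; first by exists a.
  by have [s [Ps /JP]] := Ex P QP.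
have sst' := star_f_semistar sst; rewrite -[x]mulr1.
apply: (semistar_mul sst' (embed_ideal_nz idJ a0 Ja) nE _ LJ) => _ [b Jb ->].
by apply: star_f_sub => //; rewrite mulrC.
Qed.

(** One direction is [tilde_le] on the finitely generated witness. Conversely, a quasi-maximal ideal
    is not dense, so it misses some generator of the witness, and that generator is a denominator
    for 1. *)
Lemma star_dense_tilde st I : is_semistar st -> ideal I ->
  star_dense (tilde st) I <-> star_dense st I.
Proof.
move=> sst idI; split=> -[gs [gs0 [gsI gs1]]]; exists gs; split=> //; split=> //.
  by apply/(star_f_fg sst gs0)/tilde_le => //; exact: fg_gen_nz.
move=> P QP; apply: boolp.contrapT => nP; apply: (QMax_not_dense QP).
exists gs; split=> //; split=> // g ggs; have [a Ia ga] := gsI g ggs.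
exists a => //; apply: boolp.contrapT => nPa; apply: nP; exists a; split=> //.
by rewrite mulr1 -ga; exact: fg_gen_mem.
Qed.

Lemma tilde_stable_finite_type st : is_semistar st -> stable st ->
  finite_type st -> same_op (tilde st) st.
Proof.
move=> sst stab fin E nE x; split=> [Ex|Ex P QP].
  by apply/(fin _ nE x); exact: tilde_le.
apply: boolp.contrapT => nP; apply: (QMax_not_dense QP).
(* It remains to see that the conductor (E : x), contained in [P] by [nP], is dense. For nonzero [x]
   it is the intersection of x^-1 E with A, and stability puts 1 in the closure of that
   intersection. *)
have [x0|x0] := eqVneq x 0.
  case: nP; exists 1; have [_ nP1 _] := QMax_prime sst QP; split=> //.
  by rewrite x0 mulr0; case: nE => -[].
have nxE : nzsubmod (scale_set x^-1 E) by apply: scale_set_nz; rewrite ?invr_eq0.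
have [a [a0 Ja]] := colon_nz x nE.
have nC : nzsubmod (embed_ideal (colon E x)).
  exact: embed_ideal_nz (colon_ideal x (proj1 nE)) a0 Ja.
have : st (fun y => scale_set x^-1 E y /\ Aset y) 1.
  apply/(stab _ _ nxE (@Aset_nz A)); split; last first.
    by apply: semistar_sub => //; [exact: Aset_nz | exists 1; rewrite tofrac1].
  have [_ [sc _]] := sst; apply/(sc _ _ nE); first by rewrite invr_eq0.
  by exists x; rewrite mulVf.
have CE : subset_of (fun y => scale_set x^-1 E y /\ Aset y) (embed_ideal (colon E x)).
  move=> y [[e [Ee ye]] [b yb]]; exists b => //.
  by rewrite /colon -yb ye mulrAC mulVf ?mul1r.
move=> /(semistar_mono sst _ nC CE) st1.
apply: (star_f_mono (E := embed_ideal (colon E x))).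
  move=> _ [b Jb ->]; exists b => //.
  by apply: boolp.contrapT => nPb; apply: nP; exists b.
apply/(fin _ nC 1)/st1; split; last first.
  exists a%:F; rewrite tofrac_eq0; split=> //; split; last by exists a.
  by exists (a%:F * x); rewrite mulrCA mulVf ?mulr1.
exact: submodI (proj1 nxE) (proj1 (Aset_nz A)).
Qed.

End QuasiMaximalIdeals.

(** * Coefficients of products of polynomials *)

Section PolynomialCoefficients.
Variable D : idomainType.
Local Notation K := {fraction D}.

Lemma idealN (R : idomainType) (I : R -> Prop) a : ideal I -> I a -> I (- a).
Proof. by case=> _ _ IM Ia; rewrite -mulN1r; exact: IM. Qed.

Lemma ideal_sum (R : idomainType) (I : R -> Prop) n (P : pred 'I_n) f :
  ideal I -> (forall i, P i -> I (f i)) -> I (\sum_(i < n | P i) f i).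
Proof. by case=> I0 ID _ If; elim/big_ind: _. Qed.

Lemma first_outside (R : nzRingType) (Q : R -> Prop) (f : {poly R}) :
  ~ (forall i, Q f`_i) -> exists m, ~ Q f`_m /\ forall k, (k < m)%N -> Q f`_k.
Proof.
move=> /boolp.existsNP[i /boolp.asboolPn nQ].
have ex : exists i, ~~ boolp.asbool (Q f`_i) by exists i.
case: (ex_minnP ex) => m /boolp.asboolPn nQm min; exists m; split=> // k km.
by apply: boolp.contrapT => /boolp.asboolPn/min; rewrite leqNgt km.
Qed.

(** Gauss's lemma: if m and n are the first indices at which [f] and [g] leave [Q], the coefficient
    of index m + n in [f * g] is congruent to f_m g_n modulo [Q]. *)
Lemma prime_ideal_coef (R : idomainType) (Q : R -> Prop) (f g : {poly R}) :
  prime_ideal Q -> (forall i, Q (f * g)`_i) ->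
  (forall i, Q f`_i) \/ (forall i, Q g`_i).
Proof.
move=> [idQ _ Qp] Qfg; apply: boolp.contrapT => /boolp.not_orP[].
move=> /first_outside[m [nQm minm]] /first_outside[n [nQn minn]].
suff /Qp[//|//] : Q (f`_m * g`_n).
have lt : (m < (m + n).+1)%N by rewrite ltnS leq_addr.
have := Qfg (m + n)%N; rewrite coefM (bigD1 (Ordinal lt)) //= addKn => Qs.
have [_ QD QM] := idQ.
rewrite -[_ * _](addrK (\sum_(i < (m + n).+1 | i != Ordinal lt)
  f`_i * g`_(m + n - i))); apply: QD => //; apply: idealN => //.
apply: ideal_sum => // i; rewrite -val_eqE neq_ltn /= => /orP[/minm Qf|mi].
  by rewrite mulrC; exact: QM.
by apply/QM/minn; rewrite ltn_subLR ?ltn_add2r // -ltnS.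
Qed.

Lemma prime_ideal_polyX (R : idomainType) (P : R -> Prop) : prime_ideal P ->
  prime_ideal (fun p : {poly R} => forall i, P p`_i).
Proof.
move=> prP; have [idP nP1 _] := prP; have [P0 PD PM] := idP; split.
- split=> [i|a b Pa Pb i|a b Pb i]; first by rewrite coef0.
    by rewrite coefD; exact: PD.
  by rewrite coefM; apply: ideal_sum => // j _; exact: PM.
- by move=> /(_ 0%N); rewrite coef1.
- by move=> a b; exact: prime_ideal_coef.
Qed.

(* McCoy's argument: modulo U, multiplying x by a coefficient of g kills the
   top coefficient of x, which allows an induction on the degree of x. *)
Lemma coef_submod (U : K -> Prop) (G : {poly D} -> Prop) : submod U ->
  (forall y, (forall g i, G g -> U ((g`_i)%:F * y)) -> U y) ->
  forall n (x : {poly K}), (forall i, (n <= i)%N -> U x`_i) ->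
    (forall g k, G g -> U (map_poly (@FracField.tofrac D) g * x)`_k) ->
  forall i, U x`_i.
Proof.
move=> sU reg; have [U0 UD UM] := sU.
elim=> [|n IH] x xU gxU; first by move=> i; exact: xU.
(* Descending induction on the index [i] of the coefficient of [g], starting past its size, where
   the coefficient is 0. *)
suff key g m : G g ->
    forall i k, (size g <= i + m)%N -> U ((g`_i)%:F * x`_k).
  by move=> i; apply: reg => g j Gg; apply: (key g (size g)) => //; rewrite leq_addl.
move=> Gg; elim: m => [i k|m IHm i k gim].
  by rewrite addn0 => gi; rewrite nth_default // tofrac0 mul0r.
rewrite -coefZ; apply: IH => [j nj|h j Gh]; last first.
  by rewrite -scalerAr coefZ; apply/UM/gxU.
rewrite coefZ; move: nj; rewrite leq_eqVlt => /orP[/eqP<-|/xU]; last exact: UM.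
(* In the coefficient of index [i + n] of [g * x], the terms with l < i involve coefficients of [x]
   beyond n and those with l > i are covered by [IHm]. Hence g_i x_n lies in [U]. *)
have lt : (i < (i + n).+1)%N by rewrite ltnS leq_addr.
have := gxU g (i + n)%N Gg.
rewrite coefM (bigD1 (Ordinal lt)) //= addKn coef_map /= => Us.
rewrite -[_ * _](addrK (\sum_(j < (i + n).+1 | j != Ordinal lt)
  (map_poly (@FracField.tofrac D) g)`_j * x`_(i + n - j))).
apply: UD => //; rewrite -mulN1r -tofrac1 -tofracN; apply: (UM).
apply: submod_sum => // l; rewrite -val_eqE neq_ltn coef_map /= => /orP[li|il].
  by apply/UM/xU; rewrite ltn_subRL ltn_add2r.
by apply: IHm; rewrite (leq_trans gim) // addnS -addSn leq_add2r.
Qed.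

End PolynomialCoefficients.

(** * Common denominators *)

Section PolynomialFractions.
Variable R : idomainType.

Lemma common_denominator n (e : nat -> {fraction R}) :
  exists (d : R) (b : nat -> R), d != 0 /\
    forall i, (i < n)%N -> e i = (b i)%:F / d%:F.
Proof.
pose d i := \d_(repr (e i)).
exists (\prod_(i < n) d i), (fun i => \n_(repr (e i)) * \prod_(j < n | j != i :> nat) d j).
split; first by apply/prodf_neq0 => i _; exact: denom_ratioP.
move=> i lt; set b := \prod_(j < n | _) _.
have -> : \prod_(j < n) d j = d i * b by rewrite (bigD1 (Ordinal lt)).
rewrite [LHS]frac_numden !tofracM -mulf_div mulfV ?mulr1 // tofrac_eq0.
by apply/prodf_neq0 => j _; exact: denom_ratioP.
Qed.

End PolynomialFractions.

(** * The operation on D[X]: semistar axioms, stability and finite type *)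

Section Bracket.
Variable D : idomainType.
Local Notation K := {fraction D}.
Local Notation D1 := {poly D}.
Local Notation K1 := {fraction {poly D}}.
Local Notation D1Y := {poly {poly D}}.
Implicit Types (st : (K -> Prop) -> (K -> Prop)) (E G : K1 -> Prop).
Implicit Types (x : K1) (s t : D1Y) (Q : D1 -> Prop).

(** Frees [incl] from the representative chosen in its definition. *)
Lemma incl_div (n d : D1) : d != 0 ->
  incl (n%:F / d%:F) = n%:P%:F / d%:P%:F.
Proof.
move=> d0; rewrite /incl; set r := repr _.
have r0 : \d_r != 0 := denom_ratioP r.
have /eqP := frac_numden (n%:F / d%:F).
rewrite -/r eqr_div ?tofrac_eq0 // -!tofracM tofrac_eq => /eqP e.
by apply/eqP; rewrite eqr_div ?tofrac_eq0 ?polyC_eq0 // -!tofracM -!polyCM e.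
Qed.

Lemma inclM (a : D1) x : incl (a%:F * x) = a%:P%:F * incl x.
Proof.
rewrite [x]frac_numden; set n := \n__; set d := \d__.
have d0 : d != 0 := denom_ratioP _.
by rewrite mulrA -tofracM !incl_div // polyCM tofracM mulrA.
Qed.

Lemma coef_mul_mem E s t x : submod E ->
  (forall i j, E ((s`_i)%:F * ((t`_j)%:F * x))) ->
  forall k, E (((s * t)`_k)%:F * x).
Proof.
move=> sE st_x k; rewrite coefM rmorph_sum mulr_suml /=.
by apply: submod_sum => // i _; rewrite tofracM -mulrA.
Qed.

Lemma Sset1 st : Sset st 1.
Proof. by move=> Q [[_ nQ1 _] _] /(_ 0%N); rewrite coef1. Qed.

Lemma Sset_mul st s t : Sset st s -> Sset st t -> Sset st (s * t).
Proof.
move=> Ss St Q DQ /(prime_ideal_coef (proj1 DQ))[]; [exact: Ss | exact: St].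
Qed.

(** The zero ideal of D[X] is prime and contracts to zero, so it belongs to [Delta]. *)
Lemma Sset_neq0 st s : Sset st s -> s != 0.
Proof.
move=> Ss; apply/eqP => s0; apply: (Ss (fun p => p = 0)); last first.
  by move=> i; rewrite s0 coef0.
split; last by left=> d /eqP; rewrite polyC_eq0 => /eqP.
split; last by move=> a b /eqP; rewrite mulf_eq0 => /orP[] /eqP; [left|right].
  by split=> // [a b -> ->|a b ->]; rewrite ?addr0 ?mulr0.
by apply/eqP; rewrite oner_eq0.
Qed.

(** Comparing coefficients of Y^j in s x = sum f_i e_i expresses s_j x as a combination of the e_i.
    Conversely, s x is the sum of the Y^j (s_j x). *)
Lemma bracketE st E x : submod E ->
  bracket st E x <-> exists2 s, Sset st s & forall j, E ((s`_j)%:F * x).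
Proof.
move=> sE; have [E0 ED EM] := sE; split=> [[s [Ss [n [f [e [eE xE]]]]]]|[s Ss sx]].
  exists s => // j; have s0 := Sset_neq0 Ss.
  (* Index n carries [x], so that [x] and all the e_i share one denominator and the relation becomes
     one between polynomials in Y. *)
  have [d [b [d0 eb]]] := common_denominator n.+1 (fun i => if (i < n)%N then e i else x).
  have ei (i : 'I_n) : e i = (b i)%:F / d%:F.
    by have := eb i; rewrite ltnS ltnW // ltn_ord => ->.
  have {}eb : x = (b n)%:F / d%:F by have := eb n (leqnn _); rewrite ltnn.
  have dP0 : d%:P%:F != 0 :> {fraction D1Y} by rewrite tofrac_eq0 polyC_eq0.
  have sb : s * (b n)%:P = \sum_(i < n) f i * (b i)%:P.
    apply/eqP; rewrite -tofrac_eq tofracM rmorph_sum /=; apply/eqP.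
    apply: (mulIf (invr_neq0 dP0)); rewrite mulr_suml -mulrA -incl_div // -eb xE.
    rewrite mulrC divfK ?tofrac_eq0 //; apply: eq_bigr => i _.
    by rewrite tofracM -mulrA -incl_div // -ei.
  have -> : (s`_j)%:F * x = \sum_(i < n) ((f i)`_j)%:F * e i.
    rewrite eb mulrA -tofracM -coefMC sb coef_sum rmorph_sum mulr_suml.
    by apply: eq_bigr => i _; rewrite /= ei coefMC tofracM mulrA.
  by apply: submod_sum => // i _; apply/EM/eE.
exists s; split=> //; exists (size s), (fun j => 'X^j), (fun j => (s`_j)%:F * x).
split=> //; apply: (canRL (mulfK _)); first by rewrite tofrac_eq0 (Sset_neq0 Ss).
rewrite mulrC -{1}[s]coefK poly_def rmorph_sum mulr_suml; apply: eq_bigr => j _.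
by rewrite /= inclM mulrA -tofracM -mul_polyC [_%:P * _]mulrC.
Qed.

Lemma bracket_semistar st : is_semistar (bracket st).
Proof.
have S1 := @Sset1 st.
have bE E x := @bracketE st E x.
have sub E : nzsubmod E -> subset_of E (bracket st E).
  move=> [sE _] x Ex; apply/bE => //; exists 1 => // j.
  by have [_ _ EM] := sE; exact: EM.
have sb E : submod E -> submod (bracket st E).
  move=> sE; have [E0 ED EM] := sE; split.
  - by apply/bE => //; exists 1 => // j; rewrite mulr0.
  - move=> x y /(bE _ _ sE)[s Ss sx] /(bE _ _ sE)[t St ty]; apply/bE => //.
    exists (s * t); first exact: Sset_mul.
    move=> k; rewrite mulrDr; apply: ED; last first.
      by apply: coef_mul_mem => // i j; exact: EM.
    by apply: coef_mul_mem => // i j; rewrite mulrCA; exact: EM.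
  - move=> a x /(bE _ _ sE)[s Ss sx]; apply/bE => //; exists s => // j.
    by rewrite mulrCA; exact: EM.
have nz E : nzsubmod E -> nzsubmod (bracket st E).
  move=> nE; split; first by case: nE => /sb.
  by have [_ [e [e0 Ee]]] := nE; exists e; split=> //; exact: sub.
split; first exact: nz.
split=> [E x nE x0 y|].
  have sxE := proj1 (scale_set_nz nE x0); have [sE _] := nE.
  split=> [/(bE _ _ sxE)[s Ss sy]|[e [/(bE _ _ sE)[s Ss se] ->]]].
    exists (x^-1 * y); rewrite mulVKf //; split=> //; apply/bE => //; exists s => // j.
    by have [e [Ee sye]] := sy j; rewrite mulrCA sye mulKf.
  apply/bE => //; exists s => // j; exists ((s`_j)%:F * e).
  by rewrite mulrCA; split.
split=> [E G [sE _] [sG _] EG x /(bE _ _ sE)[s Ss sx]|].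
  by apply/bE => //; exists s => // j; exact: EG.
split=> // E nE x; split; last by apply: sub => //; exact: nz.
have [sE _] := nE; move=> /(bE _ _ (sb _ sE))[s Ss sx]; apply/bE => //.
have {}sx j : exists t, Sset st t /\ forall i, E ((t`_i)%:F * ((s`_j)%:F * x)).
  by have /(bE _ _ sE)[t St tx] := sx j; exists t.
have [t tP] := boolp.choice sx.
(* Each s_j x has its own multiplier t_j. Only the indices below [size s] matter, and [u] is the
   product of those t_j. *)
suff [u Su uP] : exists2 u, Sset st u &
    forall j, (j < size s)%N -> forall i, E ((u`_i)%:F * ((s`_j)%:F * x)).
  exists (u * s); first exact: Sset_mul.
  apply: coef_mul_mem => // i j; have [/uP|js] := ltnP j (size s); first exact.
  by rewrite (nth_default _ js) tofrac0 mul0r mulr0; case: sE.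
have [_ _ EM] := sE; elim: (size s) => [|n [u Su uP]]; first by exists 1.
exists (u * t n); first by apply: Sset_mul => //; case: (tP n).
move=> j; rewrite ltnS leq_eqVlt => /orP[/eqP-> i|/uP uj i].
  by apply: coef_mul_mem => // k l; apply: EM; case: (tP n).
by apply: coef_mul_mem => // k l; rewrite mulrCA; exact: EM.
Qed.

(** If [s] multiplies x into [E] and [t] multiplies x into [G], then [s * t] does both. *)
Lemma bracket_stable st : stable (bracket st).
Proof.
move=> E G [sE _] [sG _] x; split=> [/(bracketE _ _ (submodI sE sG))[s Ss sx]|].
  by split; apply/bracketE => //; exists s => // j; case: (sx j).
move=> [/(bracketE _ _ sE)[s Ss sx] /(bracketE _ _ sG)[t St tx]].
apply/(bracketE _ _ (submodI sE sG)); exists (s * t); first exact: Sset_mul.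
move=> k; split; apply: coef_mul_mem => // i j; last by case: sG => _ _; exact.
by rewrite mulrCA; case: sE => _ _; exact.
Qed.

Lemma bracket_finite_type st : finite_type (bracket st).
Proof.
move=> E nE x; split=> [|Ex]; last exact: (star_f_le (bracket_semistar st) nE).
have [sE [e [e0 Ee]]] := nE => /(bracketE _ _ sE)[s Ss sx].
(* The products s_j x generate enough of [E]; [e] supplies a nonzero generator in case [x = 0]. *)
pose gs := e :: [seq (s`_j)%:F * x | j <- iota 0 (size s)].
have gs0 : exists2 g, g \in gs & g != 0 by exists e; rewrite ?inE ?eqxx.
exists gs; split=> //; split=> [g|].
  by rewrite inE => /orP[/eqP->//|/mapP[j _ ->]].
apply/(bracketE _ _ (fg_gen_submod gs)); exists s => // j.
have [js|js] := ltnP j (size s).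
  apply: fg_gen_mem; rewrite inE; apply/orP; right.
  by apply/mapP; exists j; rewrite ?mem_iota.
by rewrite nth_default // tofrac0 mul0r; case: (fg_gen_submod gs).
Qed.

(** * Dependence of the operation on the dense ideals of D *)

Lemma contraction_ideal Q : ideal Q -> ideal (fun d : D => Q d%:P).
Proof.
move=> [Q0 QD QM]; split=> [|a b|a b]; rewrite ?polyC0 ?polyCD ?polyCM //.
  exact: QD.
exact: QM.
Qed.

(** The closure of the contraction fills D^star as soon as it contains 1, so its being strictly
    smaller means that the contraction is not dense. *)
Lemma DeltaE st Q : is_semistar st ->
  Delta st Q <-> prime_ideal Q /\
    ((forall d : D, Q d%:P -> d = 0) \/
     ((forall p : D1, Q p <-> forall i, Q (p`_i)%:P) /\
      ~ star_dense st (fun d : D => Q d%:P))).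
Proof.
move=> sst; split=> -[prQ [Q0|]]; do ?by split=> //; left.
  move=> [QE [_ nQ]]; split=> //; right; split=> // dQ; apply: nQ.
  have [a [a0 Qa]] := star_dense_nz dQ; have [idQ _ _] := prQ.
  have nI := embed_ideal_nz (contraction_ideal idQ) a0 Qa.
  move=> y /(star_f_Aset sst); have sst' := star_f_semistar sst.
  apply: (semistar_least sst' (@Aset_nz D) nI) => _ [b ->].
  by rewrite -[b%:F]mulr1; case: (star_f_nz sst nI) => -[_ _ IM] _; exact: IM.
move=> [QE nQ]; split=> //; right; split=> //; split=> [y Qy|AQ].
  apply/(star_f_Aset sst); apply: star_f_mono Qy => _ [a _ ->]; by exists a.
apply: nQ; apply: AQ; apply: semistar_sub => //; first exact: Aset_nz.
by exists 1; rewrite tofrac1.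
Qed.

Lemma Delta_sub st1 st2 Q : is_semistar st1 -> is_semistar st2 ->
  (forall I, ideal I -> star_dense st2 I -> star_dense st1 I) ->
  Delta st1 Q -> Delta st2 Q.
Proof.
move=> sst1 sst2 dense /(DeltaE Q sst1)[prQ H]; apply/(DeltaE Q sst2); split=> //.
case: H => [Q0|[QE nQ]]; [by left | right; split=> //].
by apply: contra_not nQ; apply/dense/contraction_ideal; case: prQ.
Qed.

Lemma bracket_ext st1 st2 : is_semistar st1 -> is_semistar st2 ->
  (forall I, ideal I -> star_dense st1 I <-> star_dense st2 I) ->
  same_op (bracket st1) (bracket st2).
Proof.
move=> sst1 sst2 dense E _ x.
have DQ Q : Delta st1 Q <-> Delta st2 Q.
  by split; apply: Delta_sub => // I idI; case: (dense I idI).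
have SS s : Sset st1 s <-> Sset st2 s by split=> Ss Q /DQ; exact: Ss.
by split=> -[s [/SS Ss sx]]; exists s.
Qed.

(** * Preservation of (semi)star operations *)

Lemma Sset_denominator st s x : Sset st s -> (forall j, Aset ((s`_j)%:F * x)) ->
  exists2 d : D, d != 0 & Aset (d%:P%:F * x).
Proof.
(* The ideals containing a nonzero constant form a finitary, product-closed family. Were the
   conductor of x outside it, a prime contracting to zero would contain all coefficients of [s]. *)
move=> Ss sx; pose L (J : D1 -> Prop) := exists2 d : D, d != 0 & J d%:P.
have finL : finitary L.
  move=> J _ [d d0 Jd]; exists [:: d%:P]; split.
    by move=> g; rewrite inE => /eqP->.
  by move=> I _ dI; exists d => //; apply: dI; rewrite inE.
have mulL : product_closed L.
  move=> I J H _ _ _ [c c0 Ic] [d d0 Jd] IJH; exists (c * d); rewrite ?mulf_neq0 //.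
  by rewrite polyCM; exact: IJH.
suff : L (colon (@Aset D1) x) by [].
apply: boolp.contrapT => nL.
have [|P maxP JP] := maximal_avoiding_exists finL _ nL.
  by apply: colon_ideal; case: (Aset_nz D1).
have prP : prime_ideal P.
  by apply: maximal_avoiding_prime maxP => //; exists 1; rewrite ?oner_neq0.
apply: (Ss P); last by move=> i; apply: JP; exact: sx.
split=> //; left=> d Pd; apply/eqP/negP => /negP d0.
by have [_ nLP _] := maxP; apply: nLP; exists d.
Qed.

(** The ideal generated by the coefficients, encoded as an intersection so that it can be applied
    directly to conductors and to primes. *)
Definition content_ideal s : D -> Prop :=
  fun c => forall I, ideal I -> (forall j i, I (s`_j)`_i) -> I c.

Lemma content_ideal_ideal s : ideal (content_ideal s).
Proof.
split=> [I [] //|a b Ca Cb I idI sI|a b Cb I idI sI]; have [_ ID IM] := idI.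
  by apply: ID; [exact: Ca | exact: Cb].
by apply: IM; exact: Cb.
Qed.

Lemma content_ideal_coef s i j : content_ideal s (s`_j)`_i.
Proof. by move=> I _; exact. Qed.

(** Otherwise some quasi-maximal [P] contains the content; its extension P[X] belongs to [Delta] and
    contains every coefficient of [s]. *)
Lemma content_dense st s : is_semistar st -> Sset st s ->
  star_dense st (content_ideal s).
Proof.
move=> sst Ss; apply: boolp.contrapT => nC.
have [|P QP CP] := QMax_exists sst (content_ideal_ideal s) _ nC.
  have s0 := Sset_neq0 Ss; exists (lead_coef (lead_coef s)).
  by rewrite !lead_coef_eq0; split=> //; exact: content_ideal_coef.
have prP := QMax_prime sst QP.
apply: (Ss (fun p => forall i, P p`_i)); last first.
  by move=> j i; apply: CP; exact: content_ideal_coef.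
apply/DeltaE => //; split; first exact: prime_ideal_polyX.
have PC c : (forall i, P (c%:P)`_i) <-> P c.
  split=> [/(_ 0%N)|Pc i]; first by rewrite coefC.
  by rewrite coefC; case: ifP => // _; case: prP => -[].
right; split=> [p|].
  by split=> [Pp i|Pp i]; [apply/PC | move: (Pp i) => /PC].
apply: contra_not (QMax_not_dense QP); apply: star_f_mono => _ [c /PC Pc ->].
by exists c.
Qed.

Lemma bracket_star st : is_semistar_star st -> is_semistar_star (bracket st).
Proof.
move=> [sst stA]; have bsst := bracket_semistar st; split=> // x.
have nA := Aset_nz D; have nA1 := Aset_nz D1; have [sA1 _] := nA1.
split; last exact: semistar_sub.
move=> /(bracketE _ _ sA1)[s Ss sx].
have [d d0 [a dx]] := Sset_denominator Ss sx.
have dP0 : d%:P%:F != 0 :> K1 by rewrite tofrac_eq0 polyC_eq0.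
have dF0 : d%:F != 0 :> K by rewrite tofrac_eq0.
have {}dx : x = a%:F / d%:P%:F by rewrite -dx mulrC mulKf.
(* [y] is x = a / d viewed as a polynomial over K; the goal becomes that its coefficients lie in
   D. *)
pose y : {poly K} := d%:F^-1 *: map_poly (@FracField.tofrac D) a.
have yA : forall i, Aset y`_i.
  apply: (@coef_submod _ _ (fun g => exists j, g = s`_j) (proj1 nA) _ (size y)).
  (* If the content C of [s] satisfies Cz in D, then 1 in C^{star_f} puts z in D^{star_f} = D^star =
     D. *)
  - move=> z sz; apply/stA/(star_f_Aset sst); rewrite -[z]mulr1.
    have [c [c0 Cc]] := star_dense_nz (content_dense sst Ss).
    have nC := embed_ideal_nz (content_ideal_ideal s) c0 Cc.
    have sst' := star_f_semistar sst.
    apply: (semistar_mul sst' nC nA _ (content_dense sst Ss)) => _ [b Cb ->].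
    apply: star_f_sub => //; rewrite mulrC.
    apply: (Cb (colon (@Aset D) z)); first exact: colon_ideal (proj1 nA).
    by move=> j i; apply: sz; exists j.
  - by move=> i yi; rewrite nth_default //; case: nA => -[].
  move=> _ k [j ->]; have [h sxh] := sx j; exists h`_k.
  rewrite -scalerAr coefZ -rmorphM coef_map /=.
  have -> : s`_j * a = d%:P * h.
    apply/eqP; rewrite -tofrac_eq !tofracM -sxh dx; apply/eqP.
    by rewrite [RHS]mulrCA [_%:P%:F * _]mulrC divfK.
  by rewrite coefCM tofracM mulKf.
rewrite dx -[a]coefK poly_def rmorph_sum mulr_suml; apply: submod_sum => // i _ /=.
have [c yc] := yA i; have {}yc : a`_i = d * c.
  by apply/eqP; rewrite -tofrac_eq tofracM -yc coefZ coef_map /= mulVKf.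
exists (c%:P * 'X^i); rewrite yc -mul_polyC polyCM -mulrA tofracM mulrC.
by rewrite mulKf.
Qed.

End Bracket.

Theorem theorem2p3 (D : idomainType)
    (st : ({fraction D} -> Prop) -> ({fraction D} -> Prop)) :
  is_semistar st ->
  (* (a) *)
  (is_semistar (bracket st) /\ stable (bracket st) /\ finite_type (bracket st) /\
   same_op (tilde (bracket st)) (bracket st) /\
   (is_semistar_star st -> is_semistar_star (bracket st))) /\
  (* (b) *)
  (same_op (bracket (tilde st)) (bracket (star_f st)) /\
   same_op (bracket (star_f st)) (bracket st)).
Proof.
move=> sst; have bsst := bracket_semistar st; have sst' := star_f_semistar sst.
have dense_f I : ideal I -> star_dense (star_f st) I <-> star_dense st I.
  by move=> _; exact: (star_f_idem (embed_ideal I) sst 1).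
split; last first.
  split; apply: bracket_ext => //; first exact: tilde_semistar.
  move=> I idI; apply: iff_trans (star_dense_tilde sst idI) _.
  by apply: iff_sym; exact: dense_f.
have stab := @bracket_stable D st; have fin := @bracket_finite_type D st.
do 3!(split; first by []).
by split; [exact: tilde_stable_finite_type | exact: bracket_star].
Qed.
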